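(* Let $n\ge 1$ and $m\ge 1$ be integers and let $\epsilon, M$ be real numbers with $0<\epsilon\le M$. Define $$C^{*}=C^{*}(n,m,\epsilon,M):=\max\Big\{\frac{n}{M}-n\ln\frac{1}{M},\ \frac{n}{\epsilon}-n\ln\frac{1}{\epsilon}\Big\}+\frac{m}{\epsilon}+m\ln\Big(\frac{(n+m)M}{\epsilon}\Big),$$ let $0<m_1\le M_1<\infty$ be the positive roots of the equation $\lambda-\ln\lambda=C^{*}-n+1$ in the unknown $\lambda>0$, and set $\kappa_{\max}:=M_1/m_1$ (so $\kappa_{\max}$ depends only on $n,m,\epsilon,M$). Then for every differentiable objective function $f:\mathbb{R}^n\to\mathbb{R}$ and every run of the Two-Sided L-BFGS algorithm on $f$ with memory depth $m$ and envelope parameters $\epsilon, M$, the inverse Hessian approximation matrices $H_{k+1}$ generated by the algorithm satisfy $$\kappa(H_{k+1})\le \kappa_{\max}<\infty$$ for every $k\ge 0$ for which $H_{k+1}$ is generated.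
   Context: Norms are Euclidean. For a symmetric positive definite matrix $A$, $\kappa(A)=\lambda_{\max}(A)/\lambda_{\min}(A)$ is the spectral condition number. Two-Sided L-BFGS algorithm. Inputs: starting point $x_0\in\mathbb{R}^n$, memory depth $m\ge1$, tolerance $\tau>0$, envelope parameters $\epsilon,M$, line-search constants $0<c_1<c_2<1$, and $\gamma_0=1$. The algorithm keeps a memory buffer (a queue, initially empty) of at most $m$ pairs of vectors $(s,y)\in\mathbb{R}^n\times\mathbb{R}^n$. For $k=0,1,2,\dots$, as long as $\|\nabla f(x_k)\|>\tau$: 1. Let $(s_1,y_1),\dots,(s_{\hat m},y_{\hat m})$, $\hat m\le m$, be the pairs currently in the buffer, ordered from oldest to newest (positions in the buffer, not iteration indices). The matrix $H_k$ is defined by $H_k:=H_k^{(\hat m)}$, where $H_k^{(0)}=\gamma_k I$ and, for $1\le j\le\hat m$, $$H_k^{(j)}=(I-\rho_j s_jy_j^T)H_k^{(j-1)}(I-\rho_j y_js_j^T)+\rho_j s_js_j^T,\qquad \rho_j=\frac{1}{y_j^Ts_j}.$$ The search direction is $p_k=-H_k\nabla f(x_k)$. 2. Choose a step length $\alpha_k>0$ satisfying the strong Wolfe conditions $f(x_k+\alpha_kp_k)\le f(x_k)+c_1\alpha_k\nabla f(x_k)^Tp_k$ and $|\nabla f(x_k+\alpha_kp_k)^Tp_k|\le c_2|\nabla f(x_k)^Tp_k|$. Set $x_{k+1}=x_k+\alpha_kp_k$. 3. Set $s_k=x_{k+1}-x_k$ and $y_k=\nabla f(x_{k+1})-\nabla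 f(x_k)$. If $$\frac{y_k^Ts_k}{\|s_k\|^2}\ge\epsilon\quad\text{and}\quad\frac{\|y_k\|^2}{y_k^Ts_k}\le M,$$ then (after removing the oldest pair if the buffer already holds $m$ pairs) append $(s_k,y_k)$ to the buffer and set $\gamma_{k+1}=\frac{s_k^Ty_k}{\|y_k\|^2}$. Otherwise leave the buffer unchanged and set $\gamma_{k+1}=\gamma_k$. Thus $H_{k+1}$ is the matrix built, as in step 1, from $\gamma_{k+1}$ and the buffer contents after step 3 of iteration $k$. *)

(* Defs.v *)
From HB Require Import structures.
From mathcomp Require Import all_boot all_order all_algebra.
From mathcomp Require Import all_classical all_reals all_analysis.

Set Implicit Arguments.
Unset Strict Implicit.
Unset Printing Implicit Defensive.

Import Order.TTheory GRing.Theory Num.Theory numFieldNormedType.Exports.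
Local Open Scope classical_set_scope.
Local Open Scope ring_scope.

Definition vdot (R : realType) (n : nat) (u v : 'cV[R]_n) : R :=
  (u^T *m v) 0 0.

(* The library norm `|u| on matrices is the sup norm. *)
Definition enorm (R : realType) (n : nat) (u : 'cV[R]_n) : R :=
  Num.sqrt (vdot u u).

(* Differentiability does not depend on the norm, so it is the library's
   [differentiable] (for the sup norm); this is the vector of partial
   derivatives. *)
Definition grad (R : realType) (n : nat) (f : 'cV[R]_n -> R)
    (x : 'cV[R]_n) : 'cV[R]_n :=
  \col_i 'D_(delta_mx i 0) f x.

Definition sym_posdef (R : realType) (n : nat) (A : 'M[R]_n) : Prop :=
  A^T = A /\ forall v : 'cV[R]_n, v != 0 -> 0 < vdot v (A *m v).

(* [eigenvalue] refers to row eigenvectors, which makes no difference to the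
   set of eigenvalues. For symmetric A and n >= 1 this set is finite and
   nonempty, so sup and inf are a maximum and a minimum. *)
Definition lambda_max (R : realType) (n : nat) (A : 'M[R]_n) : R :=
  sup [set a : R | eigenvalue A a].

Definition lambda_min (R : realType) (n : nat) (A : 'M[R]_n) : R :=
  inf [set a : R | eigenvalue A a].

(* Meaningful only for symmetric positive definite A. *)
Definition cond_number (R : realType) (n : nat) (A : 'M[R]_n) : R :=
  lambda_max A / lambda_min A.

Definition bfgs_update (R : realType) (n : nat) (H : 'M[R]_n)
    (sy : 'cV[R]_n * 'cV[R]_n) : 'M[R]_n :=
  let s := sy.1 in
  let y := sy.2 in
  let rho := 1 / vdot y s in
  (1%:M - rho *: (s *m y^T)) *m H *m (1%:M - rho *: (y *m s^T))
  + rho *: (s *m s^T).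

(* State at the beginning of an iteration; the buffer is listed from the
   oldest pair to the newest. *)
Record lbfgs_state (R : realType) (n : nat) := LbfgsState {
  iterate : 'cV[R]_n;
  buffer : seq ('cV[R]_n * 'cV[R]_n);
  gamma : R }.

Definition lbfgs_init (R : realType) (n : nat) (x0 : 'cV[R]_n) :
    lbfgs_state R n :=
  LbfgsState x0 [::] 1.

Definition inv_hessian (R : realType) (n : nat) (st : lbfgs_state R n) :
    'M[R]_n :=
  foldl (@bfgs_update R n) (gamma st)%:M (buffer st).

Definition strong_wolfe (R : realType) (n : nat) (f : 'cV[R]_n -> R)
    (c1 c2 : R) (x p : 'cV[R]_n) (alpha : R) : Prop :=
  f (x + alpha *: p) <= f x + c1 * alpha * vdot (grad f x) p /\
  `|vdot (grad f (x + alpha *: p)) p| <= c2 * `|vdot (grad f x) p|.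

Definition push_pair (T : Type) (m : nat) (b : seq T) (sy : T) : seq T :=
  rcons (if size b == m then behead b else b) sy.

(* If s = 0 or y^T s = 0, the first quotient is 0 (as x / 0 = 0) and the test
   fails because eps > 0. *)
Definition accept_pair (R : realType) (n : nat) (eps M : R)
    (s y : 'cV[R]_n) : bool :=
  (eps <= vdot y s / enorm s ^+ 2) && (enorm y ^+ 2 / vdot y s <= M).

Definition lbfgs_next (R : realType) (n m : nat) (eps M : R)
    (f : 'cV[R]_n -> R) (st : lbfgs_state R n) (x' : 'cV[R]_n) :
    lbfgs_state R n :=
  let s := x' - iterate st in
  let y := grad f x' - grad f (iterate st) in
  if accept_pair eps M s y then
    LbfgsState x' (push_pair m (buffer st) (s, y)) (vdot s y / enorm y ^+ 2)
  else LbfgsState x' (buffer st) (gamma st).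

Definition lbfgs_step (R : realType) (n m : nat) (eps M c1 c2 tau : R)
    (f : 'cV[R]_n -> R) (st st' : lbfgs_state R n) : Prop :=
  let x := iterate st in
  let p := - (inv_hessian st *m grad f x) in
  tau < enorm (grad f x) /\
  exists alpha : R, [/\ 0 < alpha,
    strong_wolfe f c1 c2 x p alpha &
    st' = lbfgs_next m eps M f st (x + alpha *: p)].

(* The iterations 0, ..., N - 1 are performed, and [st k] is the state before
   iteration k; the values of [st] beyond N are irrelevant. An infinite run is
   a sequence satisfying this for every N. *)
Definition lbfgs_run (R : realType) (n m : nat) (eps M c1 c2 tau : R)
    (f : 'cV[R]_n -> R) (x0 : 'cV[R]_n) (N : nat)
    (st : nat -> lbfgs_state R n) : Prop :=
  st 0%N = lbfgs_init x0 /\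
  forall k : nat, (k < N)%N ->
    lbfgs_step m eps M c1 c2 tau f (st k) (st k.+1).

Definition C_star (R : realType) (n m : nat) (eps M : R) : R :=
  Num.max (n%:R / M - n%:R * ln (1 / M)) (n%:R / eps - n%:R * ln (1 / eps))
  + m%:R / eps + m%:R * ln ((n + m)%:R * M / eps).

(* Main.v *)
(** Put r = M / eps. The function psi(B) = tr B - ln (det B) from which [C_star]
    is read off is not used: it is enough to follow two-sided bounds on the
    quadratic form of H through the BFGS updates. If b^-1 <= H <= h, an update
    along an accepted pair gives (b + M)^-1 <= H <= r h + 1 / eps, because the
    oblique projection 1 - s y^T / (y^T s) has norm at most sqrt r. As the
    initial scaling lies in [1/M, 1/eps], after at most m updates
    kappa(H) <= (m+1)^2 r^(m+1).

    On the other side let D = C_star - n + 1. The inequality ln x <= x - 1 gives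
    e^(D-1) >= (1 + m r) ((n+m) r)^m >= 4, whence D >= 2. The roots of
    x - ln x = D satisfy M1 >= D >= 2 and 1 / m1 >= e^(D-1), so
    M1 / m1 >= 2 (1 + m r) ((n+m) r)^m >= (m+1)^2 r^(m+1). *)

Require Import Defs.
From mathcomp Require Import all_boot all_order all_algebra.
From mathcomp Require Import all_classical all_reals all_analysis.
From mathcomp Require Import ring lra.
Import Order.TTheory GRing.Theory Num.Theory numFieldNormedType.Exports.
Local Open Scope ring_scope.

(** * Euclidean inner product and the norm of an oblique projection *)

Section Vdot.
Context {R : realType} {n : nat}.
Implicit Types u v w : 'cV[R]_n.

Lemma vdotE u v : vdot u v = \sum_i u i 0 * v i 0.
Proof. by rewrite /vdot mxE; apply: eq_bigr => i _; rewrite mxE. Qed.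

Lemma vdotC u v : vdot u v = vdot v u.
Proof. by rewrite !vdotE; apply: eq_bigr => i _; rewrite mulrC. Qed.

Lemma vdotDr u v w : vdot u (v + w) = vdot u v + vdot u w.
Proof. by rewrite /vdot mulmxDr mxE. Qed.

Lemma vdotZr a u v : vdot u (a *: v) = a * vdot u v.
Proof. by rewrite /vdot -scalemxAr mxE. Qed.

Lemma vdotDl u v w : vdot (u + v) w = vdot u w + vdot v w.
Proof. by rewrite vdotC vdotDr !(vdotC w). Qed.

Lemma vdotZl a u v : vdot (a *: u) v = a * vdot u v.
Proof. by rewrite vdotC vdotZr vdotC. Qed.

Lemma vdot0r u : vdot u 0 = 0.
Proof. by rewrite /vdot mulmx0 mxE. Qed.

Lemma vdot0l u : vdot 0 u = 0.
Proof. by rewrite vdotC vdot0r. Qed.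

Lemma vdot_ge0 u : 0 <= vdot u u.
Proof. by rewrite vdotE; apply: sumr_ge0 => i _; rewrite -expr2 sqr_ge0. Qed.

Lemma vdot_eq0 u : (vdot u u == 0) = (u == 0).
Proof.
apply/idP/eqP => [|->]; last first.
  by rewrite vdot0l.
rewrite vdotE psumr_eq0 => [/allP u0|i _]; last by rewrite -expr2 sqr_ge0.
apply/colP => i; rewrite mxE.
by have := u0 i (mem_index_enum i); rewrite mulf_eq0 orbb => /eqP.
Qed.

Lemma vdot_gt0 u : (0 < vdot u u) = (u != 0).
Proof. by rewrite lt_def vdot_ge0 andbT vdot_eq0. Qed.

Lemma enorm_sqr u : enorm u ^+ 2 = vdot u u.
Proof. by rewrite sqr_sqrtr // vdot_ge0. Qed.

Lemma cauchy_schwarz u v : vdot u v ^+ 2 <= vdot u u * vdot v v.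
Proof.
have [->|u0] := eqVneq u 0.
  by rewrite !vdot0l expr0n mul0r.
have := vdot_ge0 (vdot u u *: v + (- vdot u v) *: u).
rewrite !(vdotDl, vdotDr, vdotZl, vdotZr) (vdotC v u).
set a := vdot u u; set b := vdot u v; set c := vdot v v.
rewrite [X in 0 <= X -> _](_ : _ = a * (a * c - b ^+ 2)); last by ring.
by rewrite pmulr_rge0 ?vdot_gt0 // subr_ge0.
Qed.

(** The difference of the two sides is [|c u - b v|^2 / (b c)]. The weights add, which is the source
    of [b + M] in the effect of an update. *)
Lemma young_sq (b c : R) u v : 0 < b -> 0 < c ->
  vdot (u + v) (u + v) <= (b + c) * (vdot u u / b + vdot v v / c).
Proof.
move=> b0 c0; rewrite -subr_ge0 !(vdotDl, vdotDr) (vdotC v u).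
have := vdot_ge0 (c *: u + (- b) *: v).
rewrite !(vdotDl, vdotDr, vdotZl, vdotZr) (vdotC v u) => h.
set x := vdot u u in h *; set y := vdot u v in h *; set z := vdot v v in h *.
set q := (X in 0 <= X) in h; rewrite [leRHS](_ : _ = q / (b * c)).
  by rewrite divr_ge0 // mulr_ge0 // ltW.
by rewrite /q; field; rewrite !gt_eqF.
Qed.

(* An oblique projection and its adjoint have the same norm, which for
   [1 - s y^T / (y^T s)] is [|s| |y| / (y^T s)]: as [w] is orthogonal to [s],
   [w.w = v.(w - rho (y.w) s)], and only the component of [y] orthogonal to
   [s] contributes to [y.w]. *)
Lemma oblique_projection_le (s y v : 'cV[R]_n) : 0 < vdot y s ->
  let w := v - (vdot s v / vdot y s) *: y in
  vdot w w <= vdot s s * vdot y y / vdot y s ^+ 2 * vdot v v.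
Proof.
move=> ys0 /=; set w := v - _.
have ys_neq0 : vdot y s != 0 by rewrite gt_eqF.
have s0 : 0 < vdot s s.
  rewrite vdot_gt0; apply: contraTneq ys0 => ->.
  by rewrite vdot0r ltxx.
have sw : vdot s w = 0.
  by rewrite /w -scaleNr vdotDr vdotZr (vdotC s y); field.
pose c := vdot y w / vdot y s.
have wE : vdot w w = vdot v (w + (- c) *: s).
  rewrite {1}/w -scaleNr vdotDl vdotZl vdotDr vdotZr (vdotC v s) /c.
  by field.
clearbody w.
have yw : vdot y w ^+ 2 <= (vdot y y - vdot y s ^+ 2 / vdot s s) * vdot w w.
  have := cauchy_schwarz (y + (- (vdot y s / vdot s s)) *: s) w.
  rewrite !(vdotDl, vdotDr, vdotZl, vdotZr) sw (vdotC s y) mulr0 addr0.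
  move=> /le_trans; apply; rewrite le_eqVlt; apply/orP; left; apply/eqP.
  by field; rewrite gt_eqF.
have [w0|w0] := eqVneq w 0.
  have -> : vdot w w = 0 by apply/eqP; rewrite vdot_eq0 w0.
  by rewrite !mulr_ge0 ?invr_ge0 ?vdot_ge0 ?sqr_ge0.
have w_gt0 : 0 < vdot w w by rewrite vdot_gt0.
(* After multiplication by [w.w], Cauchy-Schwarz applies to the square of [wE]. By [sw],
   [|w - c s|^2 = |w|^2 + c^2 |s|^2], and [yw] controls [c^2]. *)
rewrite -(ler_pM2l w_gt0) -expr2 {1}wE.
apply: le_trans (cauchy_schwarz _ _) _.
rewrite [leRHS](_ : _ = vdot v v *
  (vdot s s * vdot y y / vdot y s ^+ 2 * vdot w w)); last by ring.
rewrite ler_wpM2l ?vdot_ge0 //.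
rewrite !(vdotDl, vdotDr, vdotZl, vdotZr) (vdotC w s) sw.
rewrite !mulr0 addr0 add0r.
rewrite [leLHS](_ : _ = vdot w w + vdot s s / vdot y s ^+ 2 * vdot y w ^+ 2);
  last by rewrite /c; field.
rewrite -lerBrDl.
rewrite [leRHS](_ : _ = vdot s s / vdot y s ^+ 2 *
  ((vdot y y - vdot y s ^+ 2 / vdot s s) * vdot w w)); last first.
  by field; rewrite ys_neq0 gt_eqF.
by rewrite ler_wpM2l // divr_ge0 ?vdot_ge0 ?sqr_ge0.
Qed.

End Vdot.

(** * Bounds on quadratic forms through BFGS updates *)

Section Update.
Context {R : realType} {n : nat}.
Implicit Types (H : 'M[R]_n) (s y v : 'cV[R]_n).

(** The Loewner bounds [l I <= H <= h I] for a symmetric matrix. *)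
Definition form_between (l h : R) H : Prop :=
  H^T = H /\
  forall v, l * vdot v v <= vdot v (H *m v) <= h * vdot v v.

(** The acceptance test with denominators cleared. Positivity of [y.s] is stated apart, since
    [s = y = 0] satisfies both inequalities. *)
Definition curvature_pair (eps M : R) (sy : 'cV[R]_n * 'cV[R]_n) : Prop :=
  [/\ 0 < vdot sy.2 sy.1, eps * vdot sy.1 sy.1 <= vdot sy.2 sy.1 &
      vdot sy.2 sy.2 <= M * vdot sy.2 sy.1].

Lemma accept_pairP (eps M : R) s y : 0 < eps -> accept_pair eps M s y ->
  curvature_pair eps M (s, y).
Proof.
move=> eps0; rewrite /accept_pair !enorm_sqr => /andP[h1 h2].
have s0 : 0 < vdot s s.
  rewrite lt_def vdot_ge0 andbT; apply: contraTneq h1 => ->.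
  by rewrite invr0 mulr0 -ltNge.
have ys : eps * vdot s s <= vdot y s by rewrite -ler_pdivlMr.
have ys0 : 0 < vdot y s by apply: lt_le_trans ys; rewrite mulr_gt0.
by split=> //=; rewrite -ler_pdivrMr.
Qed.

(** The lower bound is the second test inverted. For the upper one, [eps (y.s)^2 <= eps (s.s) (y.y)
    <= (y.s) (y.y)], and [y.s] cancels. *)
Lemma curvature_pair_scaling (eps M : R) s y : 0 < eps -> 0 < M ->
  curvature_pair eps M (s, y) -> M^-1 <= vdot s y / enorm y ^+ 2 <= eps^-1.
Proof.
move=> eps0 M0 [/= ys0 le_s le_y]; rewrite enorm_sqr (vdotC s y).
have y0 : 0 < vdot y y.
  rewrite vdot_gt0; apply: contraTneq ys0 => ->.
  by rewrite vdot0l ltxx.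
apply/andP; split.
  by rewrite ler_pdivlMr // mulrC ler_pdivrMr // mulrC.
rewrite ler_pdivrMr // mulrC ler_pdivlMr //.
rewrite -(ler_pM2l ys0) mulrA -expr2.
rewrite mulrC; apply: le_trans (_ : eps * (vdot y y * vdot s s) <= _).
  by rewrite ler_pM2l // cauchy_schwarz.
by rewrite mulrCA mulrC ler_pM2r.
Qed.

Lemma form_between_scalar (l h c : R) : l <= c -> c <= h ->
  form_between l h c%:M.
Proof.
move=> lc ch; split; first by rewrite tr_scalar_mx.
by move=> v; rewrite mul_scalar_mx vdotZr !ler_wpM2r ?vdot_ge0.
Qed.

Lemma form_between_weaken (l l' h h' : R) H : l' <= l -> h <= h' ->
  form_between l h H -> form_between l' h' H.
Proof.
move=> ll hh [HT Hv]; split => // v; have /andP[h1 h2] := Hv v.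
by rewrite (le_trans _ h1) ?(le_trans h2) // ler_wpM2r ?vdot_ge0.
Qed.

Lemma form_between_sym_posdef (l h : R) H : 0 < l ->
  form_between l h H -> sym_posdef H.
Proof.
move=> l0 [HT Hv]; split => // v v0; have /andP[+ _] := Hv v.
by apply: lt_le_trans; rewrite mulr_gt0 // vdot_gt0.
Qed.

Lemma trmx_rank1_perturbation (a : R) s y :
  (1%:M - a *: (s *m y^T))^T = 1%:M - a *: (y *m s^T).
Proof. by rewrite [LHS]linearB /= trmx1 linearZ /= trmx_mul trmxK. Qed.

(** The outer factors of the update are transposes of each other, and the right one maps [v] to
    [w]. *)
Lemma bfgs_update_form H s y v :
  let w := v - (vdot s v / vdot y s) *: y in
  vdot v (bfgs_update H (s, y) *m v) =
  vdot w (H *m w) + vdot s v ^+ 2 / vdot y s.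
Proof.
move=> w; rewrite /bfgs_update /= div1r.
have wE : (1%:M - (vdot y s)^-1 *: (y *m s^T)) *m v = w.
  rewrite mulmxBl mul1mx -scalemxAl -mulmxA [s^T *m v]mx11_scalar.
  by rewrite -/(vdot s v) mul_mx_scalar scalerA mulrC.
have wTE : v^T *m (1%:M - (vdot y s)^-1 *: (s *m y^T)) = w^T.
  by rewrite -wE trmx_mul trmx_rank1_perturbation.
rewrite [X in vdot v X = _]mulmxDl vdotDr; congr (_ + _).
  by rewrite {1}/vdot !mulmxA wTE -mulmxA wE /vdot mulmxA.
rewrite -scalemxAl vdotZr -mulmxA [s^T *m v]mx11_scalar -/(vdot s v).
by rewrite mul_mx_scalar vdotZr (vdotC v s) mulrC expr2.
Qed.

Lemma bfgs_update_tr H sy : H^T = H ->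
  (bfgs_update H sy)^T = bfgs_update H sy.
Proof.
move=> HT; rewrite /bfgs_update /= [LHS]linearD /=; congr (_ + _).
  by rewrite !trmx_mul !trmx_rank1_perturbation HT mulmxA.
by rewrite [LHS]linearZ /= trmx_mul trmxK.
Qed.

Lemma bfgs_update_form_between (eps M b h : R) H sy :
  0 < eps -> 0 < M -> 0 < b -> 0 <= h ->
  curvature_pair eps M sy -> form_between b^-1 h H ->
  form_between (b + M)^-1 (h * (M / eps) + eps^-1) (bfgs_update H sy).
Proof.
case: sy => s y eps0 M0 b0 h0 [/= ys0 le_s le_y] [HT Hv].
have ys_neq0 : vdot y s != 0 by rewrite gt_eqF.
split; first exact: bfgs_update_tr.
move=> v; rewrite bfgs_update_form.
have := @oblique_projection_le _ _ s y v ys0.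
set w := v - _ => /= w_le.
have /andP[lo hi] := Hv w; apply/andP; split.
- rewrite mulrC ler_pdivrMr ?addr_gt0 // mulrC.
  (* [young_sq] with weights [b] and [M]: the [w] part is absorbed by the form of [H], the [y] part
     by the rank-one term, as [y.y <= M (y.s)]. *)
  have {1 2}-> : v = w + (vdot s v / vdot y s) *: y by rewrite subrK.
  apply: le_trans (young_sq _ _ _ _ b0 M0) _.
  rewrite ler_wpM2l ?addr_ge0 ?(ltW b0) ?(ltW M0) // lerD //.
    by rewrite mulrC.
  rewrite vdotZl vdotZr ler_pdivrMr // mulrA -expr2.
  rewrite [leRHS](_ : _ = (vdot s v / vdot y s) ^+ 2 * (M * vdot y s)).
    by rewrite ler_wpM2l ?sqr_ge0.
  by field.
(* The two acceptance inequalities bound the squared norm [(s.s) (y.y) / (y.s)^2] of the projection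
   by [M / eps]. *)
- rewrite mulrDl lerD //.
    apply: le_trans hi _; rewrite -mulrA ler_wpM2l //.
    apply: le_trans w_le _; rewrite ler_wpM2r ?vdot_ge0 //.
    rewrite ler_pdivrMr ?exprn_gt0 //.
    rewrite [leRHS](_ : _ = (eps^-1 * vdot y s) * (M * vdot y s)).
      by rewrite ler_pM ?vdot_ge0 // ler_pdivlMl.
    by field; rewrite gt_eqF.
  rewrite ler_pdivrMr //; apply: le_trans (cauchy_schwarz _ _) _.
  by rewrite mulrAC ler_wpM2r ?vdot_ge0 // ler_pdivlMl.
Qed.

Lemma foldl_bfgs_form_between (eps M g : R) (b : seq ('cV[R]_n * 'cV[R]_n)) :
  0 < eps -> eps <= M -> M^-1 <= g -> g <= eps^-1 ->
  (forall sy, sy \in b -> curvature_pair eps M sy) ->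
  form_between ((size b).+1%:R * M)^-1
    ((size b).+1%:R * (M / eps) ^+ size b / eps)
    (foldl (@bfgs_update R n) g%:M b).
Proof.
move=> eps0 eM g1 g2; elim/last_ind: b => [_|b sy IH good].
  by apply: form_between_scalar; rewrite /= ?expr0 ?mulr1 ?mul1r ?div1r.
have M0 : 0 < M by apply: lt_le_trans eM.
have r1 : 1 <= M / eps by rewrite ler_pdivlMr // mul1r.
rewrite -cats1 foldl_cat /= cats1 size_rcons.
set k := size b in IH *.
have h0 : 0 <= k.+1%:R * (M / eps) ^+ k / eps.
  by rewrite divr_ge0 ?mulr_ge0 ?exprn_ge0 ?divr_ge0 ?(ltW M0) ?(ltW eps0).
have kM0 : 0 < k.+1%:R * M by rewrite mulr_gt0 // ltr0n.
have good_sy : curvature_pair eps M sy.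
  by apply: good; rewrite mem_rcons mem_head.
have {}/IH : forall sy', sy' \in b -> curvature_pair eps M sy'.
  by move=> sy' sy'b; apply: good; rewrite mem_rcons inE sy'b orbT.
move=> /(bfgs_update_form_between _ _ _ _ _ _ eps0 M0 kM0 h0 good_sy).
apply: form_between_weaken.
  by rewrite -[k.+2%:R]natr1 mulrDl mul1r.
(* The term [1 / eps] added by the update is enlarged to [r^(k+1) / eps], where [r = M / eps >= 1],
   to keep a closed form. *)
rewrite (_ : k.+2%:R * _ / _ = k.+1%:R * (M / eps) ^+ k.+1 / eps +
  (M / eps) ^+ k.+1 / eps); last by rewrite -[k.+2%:R]natr1; ring.
rewrite lerD //; first by rewrite exprSr; lra.
by rewrite ler_peMl ?invr_ge0 ?(ltW eps0) ?exprn_ege1.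
Qed.

(* An empty spectrum would be harmless: the library's [sup] and [inf] of
   the empty set are both [0]. *)
Lemma cond_number_le (l h : R) H : 0 < l -> 0 <= h ->
  form_between l h H -> cond_number H <= h / l.
Proof.
move=> l0 h0 [HT Hv].
have eig a : eigenvalue H a -> l <= a <= h.
  case/eigenvalueP => u uH u0.
  have v0 : 0 < vdot u^T u^T by rewrite vdot_gt0 trmx_eq0.
  (* By symmetry a transposed row eigenvector is a column eigenvector, and its Rayleigh quotient is
     [a]. *)
  have HuT : H *m u^T = a *: u^T by rewrite -{1}HT -trmx_mul uH linearZ.
  by have := Hv u^T; rewrite HuT vdotZr !ler_pM2r.
rewrite /cond_number /lambda_max /lambda_min.
set S := (X in sup X / _).
have [->|/classical_sets.set0P S0] := eqVneq S classical_sets.set0.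
  by rewrite sup0 mul0r divr_ge0 // ltW.
have supS : sup S <= h by apply: ge_sup S0 _ => a /eig /andP[].
have infS : l <= inf S by apply: lb_le_inf S0 _ => a /eig /andP[].
apply: le_trans (_ : h / inf S <= _).
  by rewrite ler_wpM2r // invr_ge0 (le_trans _ infS) // ltW.
by rewrite ler_wpM2l // lef_pV2 // posrE (lt_le_trans l0 infS).
Qed.

End Update.

(** * Invariant of the states of a run *)

Section RunInvariant.
Context {R : realType} {n : nat}.

(** The disjunction separates the states before the first accepted pair: the initial [gamma = 1] may
    lie outside [[1/M, 1/eps]]. *)
Definition good_state (m : nat) (eps M : R) (st : lbfgs_state R n) : Prop :=
  [/\ (size (buffer st) <= m)%N,
      forall sy, sy \in buffer st -> curvature_pair eps M sy &
      (buffer st = [::] /\ gamma st = 1) \/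
      (M^-1 <= gamma st /\ gamma st <= eps^-1)].

Lemma lbfgs_next_good (m : nat) (eps M : R) (f : 'cV[R]_n -> R) st x' :
  (1 <= m)%N -> 0 < eps -> eps <= M -> good_state m eps M st ->
  good_state m eps M (lbfgs_next m eps M f st x').
Proof.
move=> m1 eps0 eM [sz good gam]; rewrite /lbfgs_next.
have M0 : 0 < M by apply: lt_le_trans eM.
case: ifP => [/(accept_pairP _ _ _ _ eps0) acc|_]; last by split.
split=> /=; last first.
- right; have /andP[h1 h2] := curvature_pair_scaling _ _ _ _ eps0 M0 acc.
  by split.
- move=> sy; rewrite /push_pair mem_rcons inE => /predU1P[->//|].
  by case: ifP => _ ?; apply: good => //; apply: mem_behead.
(* A full buffer keeps its size [m] because [m >= 1]. *)
- rewrite /push_pair size_rcons; case: ifP => [/eqP bm|/eqP nm].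
    by rewrite size_behead bm prednK.
  by rewrite ltn_neqAle sz andbT; apply/eqP.
Qed.

Lemma lbfgs_run_good (m : nat) (eps M c1 c2 tau : R) (f : 'cV[R]_n -> R) x0
    (N : nat) st :
  (1 <= m)%N -> 0 < eps -> eps <= M ->
  lbfgs_run m eps M c1 c2 tau f x0 N st ->
  forall k, (k <= N)%N -> good_state m eps M (st k).
Proof.
move=> m1 eps0 eM [st0 stS]; elim=> [_|k IH kN].
  by rewrite st0; split=> //; left.
have [_ [alpha [_ _ ->]]] := stS k kN.
by apply: lbfgs_next_good => //; apply: IH; apply: ltnW.
Qed.

End RunInvariant.

(** * Roots of [x - ln x = D] and a lower bound on [C_star] *)

Section Roots.
Context {R : realType}.

Lemma ln_lt_sub1 (x : R) : 0 < x -> x != 1 -> ln x < x - 1.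
Proof.
move=> x0 x1; rewrite ltrBrDl -{2}(lnK x0) expR_gt1Dx // ln_eq0 //.
Qed.

Lemma ln_le_sub1 (x : R) : 0 < x -> ln x <= x - 1.
Proof.
by move=> x0; rewrite lerBrDl -{2}(lnK x0) expR_ge1Dx.
Qed.

(** Apply [ln x < x - 1] at [x = a / b]: then [ln b - ln a > (b - a) / b >= b - a]. *)
Lemma sub_ln_decr (a b : R) : 0 < a -> a < b -> b <= 1 ->
  b - ln b < a - ln a.
Proof.
move=> a0 ab b1; have b0 : 0 < b by apply: lt_trans ab.
have := ln_lt_sub1 (a / b) (divr_gt0 a0 b0).
rewrite ln_div ?posrE // lt_eqF ?ltr_pdivrMr ?mul1r // => /(_ isT) h.
have : b - a <= (b - a) / b.
  by rewrite ler_pdivlMr // ler_piMr // subr_ge0 ltW.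
have -> : (b - a) / b = 1 - a / b by field; rewrite gt_eqF.
lra.
Qed.

Lemma sub_ln_incr (a b : R) : 1 <= a -> a < b -> a - ln a < b - ln b.
Proof.
move=> a1 ab; have a0 : 0 < a by apply: lt_le_trans a1.
have b0 : 0 < b by apply: lt_trans ab.
have := ln_lt_sub1 (b / a) (divr_gt0 b0 a0).
rewrite ln_div ?posrE // gt_eqF ?ltr_pdivlMr ?mul1r // => /(_ isT) h.
have : (b - a) / a <= b - a.
  by rewrite ler_pdivrMr // ler_peMr // subr_ge0 ltW.
have -> : (b - a) / a = b / a - 1 by field; rewrite gt_eqF.
lra.
Qed.

(** The function decreases up to its minimum value 1 at [x = 1], then increases. Existence on each
    side comes from the intermediate value theorem, uniqueness from strict monotonicity. *)
Lemma sub_ln_roots (D : R) : 1 < D ->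
  exists m1 M1 : R, [/\ 0 < m1, m1 < 1, 1 < M1 &
    forall x, 0 < x -> x - ln x = D <-> x = m1 \/ x = M1].
Proof.
move=> D1.
(* In the variable [t = ln x] the function is [expR t - t]. *)
pose g (t : R) := expR t - t.
have cg : continuous g.
  by move=> t; apply: cvgB; [exact: continuous_expR | exact: cvg_id].
have g0 : g 0 = 1 by rewrite /g expR0 subr0.
have gn : D <= g (- D) by have := expR_gt0 (- D); rewrite /g; lra.
(* [expR (2 D) >= (1 + D)^2] gives [g (2 D) >= 1 + D^2 >= D]. *)
have gp : D <= g (2 * D).
  rewrite /g expRM_natl.
  have : (1 + D) ^+ 2 <= expR D ^+ 2.
    by rewrite ler_pXn2r ?nnegrE ?expR_ge0 ?expR_ge1Dx //; lra.
  nra.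
have lD : - D <= 0 by lra.
have rD : 0 <= 2 * D by lra.
have [|t1] := IVT (v := D) lD (continuous_subspaceT cg).
  by rewrite g0 ge_min le_max gn (ltW D1) orbT.
rewrite in_itv /= => /andP[_ t10] gt1.
have [|t2] := IVT (v := D) rD (continuous_subspaceT cg).
  by rewrite g0 ge_min le_max gp (ltW D1) orbT.
rewrite in_itv /= => /andP[t20 _] gt2.
have t1n : t1 < 0.
  rewrite lt_neqAle t10 andbT; apply: contra_eqN gt1 => /eqP ->.
  by rewrite g0 lt_eqF.
have t2n : 0 < t2.
  rewrite lt_neqAle t20 andbT; apply: contra_eqN gt2 => /eqP <-.
  by rewrite g0 lt_eqF.
have e1 : expR t1 < 1 by rewrite expR_lt1.
have e2 : 1 < expR t2 by rewrite expR_gt1.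
have r1 : expR t1 - ln (expR t1) = D by rewrite expRK.
have r2 : expR t2 - ln (expR t2) = D by rewrite expRK.
exists (expR t1), (expR t2); split; rewrite ?expR_gt0 //.
move=> x x0; split=> [xD|[->|->] //].
have [x1|x1] := leP x 1.
  left; case: (ltgtP x (expR t1)) => // h.
    by have := sub_ln_decr _ _ x0 h (ltW e1); rewrite xD r1 ltxx.
  by have := sub_ln_decr _ _ (expR_gt0 _) h x1; rewrite xD r1 ltxx.
right; case: (ltgtP x (expR t2)) => // h.
  by have := sub_ln_incr _ _ (ltW x1) h; rewrite xD r2 ltxx.
by have := sub_ln_incr _ _ (ltW e2) h; rewrite xD r2 ltxx.
Qed.

(** Keep the first entry of the maximum. Minus [n] it is [n] times a nonnegative bracket, so at
    least the bracket itself; then use [ln x <= x - 1] at [x = (1 + m M / eps) / M]. *)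
Lemma C_star_ge (n m : nat) (eps M : R) : (1 <= n)%N -> 0 < eps ->
  eps <= M ->
  ln (1 + m%:R * (M / eps)) + m%:R * ln ((n + m)%:R * M / eps) <=
  C_star n m eps M - n%:R.
Proof.
move=> n1 eps0 eM; rewrite /C_star.
have M0 : 0 < M by apply: lt_le_trans eM.
set A := _ / M - _; set B := _ / eps - _.
have : A <= Num.max A B by rewrite le_max lexx.
set mx := Num.max A B; set L := m%:R * ln _ => Amx.
suff : ln (1 + m%:R * (M / eps)) <= A - n%:R + m%:R / eps by lra.
have i0 : 0 < 1 / M by rewrite divr_gt0.
have q0 : 0 < 1 + m%:R * (M / eps).
  by rewrite ltr_pwDl // mulr_ge0 // divr_ge0 // ltW.
have -> : A - n%:R = n%:R * (1 / M - 1 - ln (1 / M)) by rewrite /A; ring.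
have n1' : 1 <= n%:R :> R by rewrite ler1n.
have := ln_le_sub1 (1 / M) i0.
rewrite -subr_ge0 => h.
have : 1 / M - 1 - ln (1 / M) <= n%:R * (1 / M - 1 - ln (1 / M)).
  by rewrite ler_peMl.
have := ln_le_sub1 _ (mulr_gt0 q0 i0).
rewrite lnM ?posrE //.
have -> : (1 + m%:R * (M / eps)) * (1 / M) = 1 / M + m%:R / eps.
  by field; rewrite !gt_eqF.
lra.
Qed.

End Roots.

Theorem theorem6 (R : realType) (n m : nat) (eps M : R)
  (hn : (1 <= n)%N) (hm : (1 <= m)%N) (heps : 0 < eps) (hepsM : eps <= M) :
  exists m1 M1 : R,
    [/\ 0 < m1,
        m1 <= M1,
        (forall lambda : R, 0 < lambda ->
          (lambda - ln lambda = C_star n m eps M - n%:R + 1 <->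
           lambda = m1 \/ lambda = M1)) &
        forall (f : 'cV[R]_n -> R) (c1 c2 tau : R) (x0 : 'cV[R]_n)
               (N : nat) (st : nat -> lbfgs_state R n),
          (forall x : 'cV[R]_n, differentiable f x) ->
          0 < c1 -> c1 < c2 -> c2 < 1 -> 0 < tau ->
          lbfgs_run m eps M c1 c2 tau f x0 N st ->
          forall k : nat, (k < N)%N ->
            sym_posdef (inv_hessian (st k.+1)) /\
            cond_number (inv_hessian (st k.+1)) <= M1 / m1].
Proof.
set D := C_star n m eps M - n%:R + 1.
have M0 : 0 < M by apply: lt_le_trans hepsM.
set r := M / eps.
have r1 : 1 <= r by rewrite ler_pdivlMr // mul1r.
have r0 : 0 <= M / eps by rewrite -/r; lra.
set q := 1 + m%:R * r; set p := (n + m)%:R * r.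
have m1' : 1 <= m%:R :> R by rewrite ler1n.
have nm : m%:R + 1 <= (n + m)%:R :> R by rewrite addnC natrD lerD2l ler1n.
have q2 : 2 <= q by rewrite /q; nra.
have p2 : 2 <= p by rewrite /p; nra.
have Dge : q * p ^+ m <= expR (D - 1).
  rewrite -[q]lnK ?posrE; last by lra.
  rewrite -[p]lnK ?posrE; last by lra.
  rewrite -expRM_natl -expRD ler_expR /D addrK.
  by rewrite /p /r mulrA C_star_ge.
have D2 : 2 <= D.
  have p2m : 2 <= p ^+ m by rewrite (le_trans p2) // ler_eXnr //; lra.
  have : 4 <= expR (D - 1) by apply: le_trans Dge; nra.
  (* From [expR (-1/2) >= 1/2], inverted and squared. *)
  have e4 : expR 1 <= 4 :> R.
    have h : 2^-1 <= expR (- 2^-1) :> R.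
      by apply: le_trans (expR_ge1Dx _); lra.
    have h2 : expR 2^-1 <= 2 :> R.
      by rewrite -[X in expR X]opprK expRN -[leRHS]invrK lef_pV2 // posrE ?expR_gt0.
    rewrite (_ : 1 = 2^-1 + 2^-1); last by lra.
    by rewrite expRD; have := expR_gt0 (2^-1 : R); nra.
  move=> /(le_trans e4); rewrite ler_expR; lra.
have [|m1 [M1 [m10 m1lt M1gt roots]]] := sub_ln_roots D; first by lra.
exists m1, M1; split=> //; first by lra.
have m1root : m1 - ln m1 = D by apply/roots => //; left.
have M1root : M1 - ln M1 = D by apply/roots; [lra|right].
have M1ge : 2 <= M1 by have := ln_gt0 M1gt; lra.
(* Since [m1 < 1], [- ln m1 = D - m1 >= D - 1]. *)
have m1le : q * p ^+ m <= m1^-1.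
  apply: le_trans Dge _; rewrite -[m1](lnK m10) -expRN ler_expR; lra.
have kmax : (m.+1%:R * r ^+ m / eps) * (m.+1%:R * M) <= M1 / m1.
  apply: le_trans (_ : 2 * (q * p ^+ m) <= _); last first.
    by apply: ler_pM => //; rewrite mulr_ge0 ?exprn_ge0 //; lra.
  rewrite [leLHS](_ : _ = m.+1%:R * r * (m.+1%:R * r ^+ m)); last first.
    by rewrite /r; field; rewrite gt_eqF.
  (* Factorwise: [(m+1) r <= 2 q], and [(m+1) r^m <= p^m] because [m + 1 <= n + m <= (n+m)^m]. *)
  rewrite [leRHS]mulrA; apply: ler_pM.
  - by rewrite mulr_ge0 //; lra.
  - by rewrite mulr_ge0 // exprn_ge0 //; lra.
  - by rewrite -natr1 /q; nra.
  rewrite [leRHS]exprMn ler_wpM2r ?exprn_ge0 //.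
  by rewrite -natr1 (le_trans nm) // ler_eXnr // ler1n addn_gt0 hn.
move=> f c1 c2 tau x0 N st _ _ _ _ _ run k kN.
have [sz good gam] := lbfgs_run_good _ _ _ _ _ _ _ _ _ _ hm heps hepsM run _ kN.
(* With no pair accepted yet the matrix is the identity, and [M1 / m1 >= 1] since [m1 < 1 < M1]. *)
rewrite /inv_hessian; case: gam => [[-> ->]|[g1 g2]].
  have H1 : form_between 1 1 (1%:M : 'M[R]_n) by exact: form_between_scalar.
  split; first by apply: form_between_sym_posdef H1.
  apply: le_trans (cond_number_le _ _ _ _ _ H1) _ => //.
  rewrite divr1 ler_pdivlMr //; lra.
have := foldl_bfgs_form_between _ _ _ _ heps hepsM g1 g2 good.
set b := buffer _ in sz *.
have bm : (size b).+1%:R <= m.+1%:R :> R by rewrite ler_nat.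
have b0 : 0 < (size b).+1%:R :> R by [].
have rpow : r ^+ size b <= r ^+ m by rewrite ler_weXn2l.
(* The buffer may hold fewer than [m] pairs; the bounds only loosen as its size grows to [m]. *)
move=> fb0; have fb : form_between (m.+1%:R * M)^-1 (m.+1%:R * r ^+ m / eps)
    (foldl (@bfgs_update R n) (gamma (st k.+1))%:M b).
  apply: form_between_weaken fb0.
  - by rewrite lef_pV2 ?posrE ?mulr_gt0 // ler_pM2r.
  - by rewrite ler_pM2r ?invr_gt0 // ler_pM // exprn_ge0.
split; first by apply: form_between_sym_posdef fb; rewrite invr_gt0 mulr_gt0.
apply: le_trans (cond_number_le _ _ _ _ _ fb) _.
- by rewrite invr_gt0 mulr_gt0.
- by rewrite divr_ge0 ?mulr_ge0 ?exprn_ge0 ?(ltW heps).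
by rewrite invrK.
Qed.
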